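(* Let $s>s'>1$ and define $L:\mathbb{R}^2\to[0,\infty)$ by $L(x,y)=|x|^s+|y|^{s'}$. For a bounded continuous function $u:\mathbb{R}^2\to\mathbb{R}$ and $t>0$ let $u_t(z)=\inf_{v\in\mathbb{R}^2}\big(u(v)+tL\big(\tfrac{v-z}{t}\big)\big)$, $z\in\mathbb{R}^2$. Then for every $2<p<\infty$ there exists a compactly supported and radial function $u\in W^{1,p}(\mathbb{R}^2)$ such that $\|Du_t\|_{L^p(\mathbb{R}^2)}\to\infty$ as $t\to 0^+$.
   Context: Since $p>2$, every $u\in W^{1,p}(\mathbb{R}^2)$ is identified with its continuous representative. For bounded continuous $u$ and $t>0$, the function $u_t$ is Lipschitz on $\mathbb{R}^2$, hence differentiable almost everywhere; $Du_t$ is its almost everywhere defined gradient. *)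

(* Defs.v *)
From HB Require Import structures.
From mathcomp Require Import all_boot all_order all_algebra.
From mathcomp Require Import all_classical all_reals all_analysis.
Set Implicit Arguments.
Unset Strict Implicit.
Unset Printing Implicit Defensive.
Import Order.TTheory GRing.Theory Num.Theory.
Import numFieldNormedType.Exports.
Local Open Scope classical_set_scope.
Local Open Scope ring_scope.

(* The canonical norm on [R * R] is the sup norm.  It induces the
   usual topology and the usual notions of continuity, compactness and
   differentiability; wherever the Euclidean length itself matters (radial
   functions, length of a gradient), [norm2] is used instead. *)
Definition norm2 {R : realType} (z : R * R) : R := Num.sqrt (z.1 ^+ 2 + z.2 ^+ 2).

(* Two-dimensional Lebesgue measure, on the Borel sets of the plane. *)
Definition lebesgue2 {R : realType} :
    {measure set (measurableTypeR R * measurableTypeR R)%type -> \bar R} :=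
  (@lebesgue_measure R \x @lebesgue_measure R)%E.

Definition e1 {R : realType} : R * R := (1, 0).
Definition e2 {R : realType} : R * R := (0, 1).

Definition compactly_supported {R : realType} (f : R * R -> R) : Prop :=
  compact (closure [set z | f z != 0]).

Definition radial {R : realType} (f : R * R -> R) : Prop :=
  forall z w, norm2 z = norm2 w -> f z = f w.

Fixpoint Ck {R : realType} (k : nat) (f : R * R -> R) : Prop :=
  if k is k'.+1 then
    [/\ (forall z, differentiable f z), Ck k' ('D_e1 f) & Ck k' ('D_e2 f)]
  else continuous f.

Definition test_function {R : realType} (f : R * R -> R) : Prop :=
  (forall k, Ck k f) /\ compactly_supported f.

(* [g] is the weak (distributional) derivative of [f] in the direction [e]. *)
Definition weak_derivative {R : realType} (e : R * R) (f g : R * R -> R) : Prop :=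
  forall phi, test_function phi ->
    (\int[lebesgue2]_z (f z * 'D_e phi z)%:E
     = - \int[lebesgue2]_z (g z * phi z)%:E)%E.

Definition W1 {R : realType} (p : R) (f : R * R -> R) : Prop :=
  f \in Lfun lebesgue2 p%:E /\
  exists g1 g2 : R * R -> R,
    [/\ g1 \in Lfun lebesgue2 p%:E, g2 \in Lfun lebesgue2 p%:E,
        weak_derivative e1 f g1 & weak_derivative e2 f g2].

Definition lagrangian {R : realType} (s s' : R) (z : R * R) : R :=
  `|z.1| `^ s + `|z.2| `^ s'.

(* The Hopf-Lax function u_t; for bounded [u] and nonnegative [L] the set of
   values is nonempty and bounded below, so [inf] is the genuine infimum. *)
Definition hopf_lax {R : realType} (L : R * R -> R) (u : R * R -> R) (t : R)
    (z : R * R) : R :=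
  inf (range (fun v : R * R => u v + t * L (t^-1 *: (v - z)))).

(* Euclidean length of the gradient, set to 0 where [f] is not differentiable.
   For Lipschitz [f] these exceptional points form a null set (Rademacher), so
   this choice has no effect on L^p norms. *)
Definition gradient_length {R : realType} (f : R * R -> R) (z : R * R) : R :=
  if `[< differentiable f z >] then norm2 ('D_e1 f z, 'D_e2 f z) else 0.

(* Main.v *)
Require Import Defs.
From mathcomp Require Import all_boot all_order all_algebra.
From mathcomp Require Import all_classical all_reals all_analysis.
From mathcomp Require Import measurable_realfun ring lra.
Import Order.TTheory GRing.Theory Num.Theory.
Import numFieldNormedType.Exports.
Local Open Scope classical_set_scope.
Local Open Scope ring_scope.

(* Take u(z) = min(|z|^beta, 1) - 1 with beta slightly above 1 - 2/p.  Near the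
   origin the infimum defining u_t is attained at v = 0 on a whole box of size
   X by Y, where X and Y solve t L(X/t, 0) = t L(0, Y/t) = X^beta, so there
   u_t(z) = -1 + t L(z/t) and |d_x u_t| is of order X^(beta - 1).  Hence
   ||Du_t||_p^p is at least a constant times X^((beta - 1) p + 1) Y.  Since s > s',
   the box is elongated: Y/X tends to infinity like a negative power of t, which
   beats X^((beta - 1) p + 2) when beta is close enough to 1 - 2/p. *)

(** * The well at the origin *)

(** What pins the infimum to v = 0 is a comparison of the cusp with the cost. At distance at least X
    the cusp has risen by h or more, which is at least the cost of v = 0 for z in the box shrunk by
    a constant c. At distance r < X the cusp has risen by at least r h/X, because r^beta is concave
    for beta < 1, whereas the cost, being convex, can drop by at most r times its slope at z; on the
    shrunk box this slope is a fraction of h/X in x and of h/Y <= h/X in y. Hence X must be the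
    shorter side, which is where s' < s enters. Membership in W^{1,p} forces (beta - 1) p + 2 > 0,
    so the bound from a square box would tend to 0: the elongation is the only source of divergence,
    and beta has to be close to the critical exponent for it to prevail. *)

Lemma powR_tangent (R : realType) (s a r d : R) : 1 < s -> 0 < a -> 0 <= r ->
  a - d <= r -> a `^ s - s * a `^ (s - 1) * d <= r `^ s.
Proof.
move=> s1 a0 r0 adr.
have s0 : 0 < s by lra.
have s10 : 0 < s - 1 by lra.
(* Young's inequality for r and a^(s-1) with the conjugate exponents s and s/(s-1): multiplied by s,
   it is the tangent-line inequality of r^s at a. *)
have young : r * a `^ (s - 1) <= r `^ s / s + (a `^ (s - 1)) `^ (s / (s - 1)) / (s / (s - 1)).
  apply: conjugate_powR => //; first exact: powR_ge0.
    by rewrite divr_gt0.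
  by field; rewrite !gt_eqF.
move: young; rewrite -powRrM (_ : (s - 1) * (s / (s - 1)) = s); last first.
  by field; rewrite gt_eqF.
have aE : a `^ s = a * a `^ (s - 1) by rewrite mulr_powRB1// ltW.
move=> young.
have : s * (r * a `^ (s - 1)) <= r `^ s + (s - 1) * a `^ s.
  rewrite -(@ler_pM2l _ s^-1) ?invr_gt0// mulKf ?gt_eqF//.
  apply: (le_trans young); rewrite le_eqVlt; apply/orP; left; apply/eqP.
  by field; rewrite !gt_eqF.
have : 0 < a `^ (s - 1) by rewrite powR_gt0.
rewrite aE; set w := a `^ (s - 1); set rs := r `^ s => w0 H.
have : s * w * (a - d) <= s * w * r by rewrite ler_pM2l// mulr_gt0.
by move: H; lra.
Qed.

Lemma ler_powRl (R : realType) (e x y : R) :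
  0 <= e -> 0 <= x -> x <= y -> x `^ e <= y `^ e.
Proof.
move=> e0 x0 xy; apply: ge0_ler_powR; rewrite ?nnegrE//.
exact: le_trans xy.
Qed.

Lemma lagrangian_scale (R : realType) (s s' t : R) (z : R * R) : 0 < t ->
  t * lagrangian s s' (t^-1 *: z) =
  t `^ (1 - s) * `|z.1| `^ s + t `^ (1 - s') * `|z.2| `^ s'.
Proof.
move=> t0; rewrite /lagrangian /= mulrDr.
have E (e x : R) : t * `|t^-1 *: x| `^ e = t `^ (1 - e) * `|x| `^ e.
  rewrite /GRing.scale/= normrM powRM ?normr_ge0// mulrA; congr (_ * _).
  rewrite gtr0_norm ?invr_gt0// -powR_inv1 ?ltW// -powRrM mulN1r.
  rewrite powRB; last by rewrite (gt_eqF t0) implybT.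
  by rewrite powRr1 ?ltW// powRN.
by rewrite !E.
Qed.

Definition sqnorm {R : realType} (z : R * R) : R := z.1 ^+ 2 + z.2 ^+ 2.

(** [b] is half of the exponent beta: the power is taken of the polynomial [sqnorm], which keeps
    square roots out of the derivatives. *)
Definition cusp {R : realType} (b : R) (z : R * R) : R :=
  Num.min (sqnorm z `^ b) 1 - 1.

Lemma sqnorm_ge0 (R : realType) (z : R * R) : 0 <= sqnorm z.
Proof. by rewrite addr_ge0 ?sqr_ge0. Qed.

Lemma hopf_lax_eq (R : realType) (L u : R * R -> R) (t : R) (z v0 : R * R) (m : R) :
  u v0 + t * L (t^-1 *: (v0 - z)) = m ->
  (forall v, m <= u v + t * L (t^-1 *: (v - z))) -> hopf_lax L u t z = m.
Proof.
move=> um mle; rewrite /hopf_lax.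
have lbm : lbound (range (fun v => u v + t * L (t^-1 *: (v - z)))) m.
  by move=> _ [v _ <-]; exact: mle.
apply/eqP; rewrite eq_le; apply/andP; split.
  by apply: ge_inf; [exists m|exists v0].
by apply: lb_le_inf => //; exists m, v0.
Qed.

(* X and Y are the side lengths of the box on which t L(z/t) is of order
   h = X^(2b), the rise of the cusp at distance X from the origin. *)
Lemma cusp_well (R : realType) (s s' t b c h X Y : R) :
  1 < s' -> s' < s -> 0 < t -> 0 < b -> b < 2^-1 ->
  0 < c -> c `^ s + c `^ s' <= 1 -> s * c `^ (s - 1) + s' * c `^ (s' - 1) <= 1 ->
  0 < X -> X <= 1 -> X <= Y ->
  h = X `^ (2 * b) -> t `^ (1 - s) * X `^ s = h -> t `^ (1 - s') * Y `^ s' = h ->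
  forall x y, 0 < x -> x <= c * X -> 0 < y -> y <= c * Y -> forall v,
  -1 + (t `^ (1 - s) * x `^ s + t `^ (1 - s') * y `^ s') <=
  cusp b v + (t `^ (1 - s) * `|v.1 - x| `^ s + t `^ (1 - s') * `|v.2 - y| `^ s').
Proof.
move=> s'1 s's t0 b0 b1 c0 c1 c2 X0 X1 XY hE PX PY x y x0 xX y0 yY v.
set P := t `^ (1 - s) in PX *; set P' := t `^ (1 - s') in PY *.
have P0 : 0 < P by rewrite powR_gt0.
have P'0 : 0 < P' by rewrite powR_gt0.
have Y0 : 0 < Y by lra.
have s1 : 1 < s by lra.
have h0 : 0 < h by rewrite hE powR_gt0.
pose N := Num.sqrt (sqnorm v).
have N0 : 0 <= N by exact: sqrtr_ge0.
have NE : sqnorm v `^ b = N `^ (2 * b).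
  rewrite powRrM; congr (_ `^ _); rewrite -[2]/(2%:R) powR_mulrn//.
  by rewrite sqr_sqrtr// sqnorm_ge0.
have v1N : `|v.1| <= N.
  by rewrite -sqrtr_sqr ler_sqrt ?sqnorm_ge0// lerDl sqr_ge0.
have v2N : `|v.2| <= N.
  by rewrite -sqrtr_sqr ler_sqrt ?sqnorm_ge0// lerDr sqr_ge0.
rewrite /cusp NE.
have one : 1 = 1 `^ (2 * b) by rewrite powR1.
have be0 : 0 <= 2 * b by rewrite mulr_ge0// ltW.
have s0 : 0 <= s by rewrite ltW// (lt_trans ltr01).
have s'0 : 0 <= s' by rewrite ltW// (lt_trans ltr01).
(* If v is far, the rise h of the cusp alone pays for the cost of v = 0, which is at most (c^s +
   c^s') h on the box. *)
have [XN|NX] := leP X N.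
  have hmin : h <= Num.min (N `^ (2 * b)) 1.
    rewrite le_min hE; apply/andP; split.
      by apply: ler_powRl => //; exact: ltW.
    by rewrite [leRHS]one; apply: ler_powRl => //; exact: ltW.
  have A : P * x `^ s <= c `^ s * h.
    rewrite -PX mulrCA ler_pM2l// -powRM ?(ltW c0) ?(ltW X0)//.
    exact: ler_powRl (ltW x0) xX.
  have B : P' * y `^ s' <= c `^ s' * h.
    rewrite -PY mulrCA ler_pM2l// -powRM ?(ltW c0) ?(ltW Y0)//.
    exact: ler_powRl (ltW y0) yY.
  have C : (c `^ s + c `^ s') * h <= h by rewrite ler_piMl// ltW.
  have D : 0 <= P * `|v.1 - x| `^ s by rewrite mulr_ge0 ?powR_ge0// ltW.
  have E : 0 <= P' * `|v.2 - y| `^ s' by rewrite mulr_ge0 ?powR_ge0// ltW.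
  rewrite [leLHS]addrC [leRHS]addrAC lerD2r.
  apply: (le_trans (lerD A B)); rewrite -mulrDl; apply: (le_trans C).
  by apply: (le_trans hmin); rewrite lerDl addr_ge0.
(* Below X the concave function r^(2b) lies above its chord from 0 to X, whose slope is h/X. *)
have Nmin : N * (h / X) <= Num.min (N `^ (2 * b)) 1.
  have NX2 : N * (h / X) <= N `^ (2 * b).
    move: N0; rewrite le_eqVlt => /predU1P[<-|N0].
      by rewrite mul0r powR_ge0.
    have -> : h / X = X `^ (2 * b - 1).
      by rewrite hE powRB ?powRr1 ?ltW// (gt_eqF X0) implybT.
    rewrite -[leRHS]mulr_powRB1; [|exact: ltW|by rewrite mulr_gt0].
    rewrite ler_pM2l//.
    have -> : 2 * b - 1 = - (1 - 2 * b) by ring.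
    rewrite !powRN lef_pV2 ?posrE ?powR_gt0//.
    apply: ler_powRl; [|exact: ltW|exact: ltW].
    by rewrite subr_ge0 mulrC -ler_pdivlMr// mul1r ltW.
  rewrite le_min NX2/= (le_trans NX2)//.
  by rewrite [leRHS]one; apply: ler_powRl => //; rewrite ltW// (lt_le_trans NX).
(* One coordinate of the cost: a move of length at most N saves at most N times the slope at x',
   which is at most e c^(e-1) h/X'. The pair (e, X') is (s, X) or (s', Y), and X <= X' replaces h/X'
   by the common h/X. *)
have slope (e Q x' X' w : R) : 1 < e -> 0 < Q -> 0 < x' -> X <= X' ->
    x' <= c * X' -> Q * X' `^ e = h -> `|w| <= N ->
    Q * x' `^ e - e * c `^ (e - 1) * (N * (h / X)) <= Q * `|w - x'| `^ e.
  move=> e1 Q0 x'0 XX' x'X' QX' wN.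
  have := @powR_tangent R e x' `|w - x'| N e1 x'0 (normr_ge0 _).
  have -> : x' - N <= `|w - x'|.
    by rewrite distrC (le_trans _ (lerB_dist _ _))// gtr0_norm// lerB.
  move=> /(_ erefl).
  rewrite -(ler_pM2l Q0); apply: le_trans; rewrite mulrBr lerD2l lerN2.
  have X'0 : 0 < X' by exact: lt_le_trans XX'.
  have e0 : 0 < e by exact: lt_trans e1.
  have -> : Q * (e * x' `^ (e - 1) * N) = e * N * (Q * x' `^ (e - 1)) by ring.
  have -> : e * c `^ (e - 1) * (N * (h / X)) = e * N * (c `^ (e - 1) * (h / X)) by ring.
  apply: ler_wpM2l; first by rewrite mulr_ge0// ltW.
  have hX' : Q * X' `^ (e - 1) = h / X'.
    by rewrite -QX' powRB ?powRr1 ?(ltW X'0)// ?(gt_eqF X'0) ?implybT// mulrA.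
  apply: (@le_trans _ _ (c `^ (e - 1) * (h / X'))); last first.
    rewrite ler_wpM2l ?powR_ge0// ler_wpM2l ?(ltW h0)// lef_pV2//.
  rewrite -hX' mulrCA ler_wpM2l ?(ltW Q0)// -powRM ?(ltW c0) ?(ltW X'0)//.
  by apply: ler_powRl (ltW x'0) x'X'; rewrite subr_ge0 ltW.
have S1 := slope s P x X v.1 s1 P0 x0 (lexx _) xX PX v1N.
have S2 := slope s' P' y Y v.2 s'1 P'0 y0 XY yY PY v2N.
have S3 : (s * c `^ (s - 1) + s' * c `^ (s' - 1)) * (N * (h / X)) <= N * (h / X).
  by apply: ler_piMl => //; rewrite mulr_ge0// divr_ge0// ltW.
rewrite [leLHS]addrC [leRHS]addrAC lerD2r -lerBlDl.
apply: le_trans (lerD S1 S2).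
rewrite addrACA lerD2l -opprD lerN2 -mulrDl.
exact: (le_trans S3).
Qed.

(** * Lower bounds for the gradient norm *)

Lemma near_eq_differentiable (R : numFieldType) (V W : normedModType R)
    (f g : V -> W) (x : V) :
  {near x, f =1 g} -> differentiable f x -> differentiable g x.
Proof.
move=> fg df; have fgx : f x = g x by exact: nbhs_singleton fg.
have E : g \o shift x = cst (g x) + 'd f x +o_ 0 id.
  have /eqaddoP H := diff_locally df.
  apply/eqaddoP => e e0; have He := H e e0.
  have fg0 : \forall y \near (0 : V), f (y + x) = g (y + x).
    by move: fg; rewrite /prop_for (near_shift 0 x); apply: filterS => y /=; rewrite subr0.
  near=> y.
  have -> : (g \o shift x - (cst (g x) + 'd f x)) y =
    (f \o shift x - (cst (f x) + 'd f x)) y.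
    rewrite !fctE /= fgx; congr (_ - _); apply/esym; near: y; exact: fg0.
  near: y; exact: He.
have dE : 'd g x = 'd f x :> (V -> W) by apply: diff_unique => //; exact: diff_continuous.
by apply/diff_locallyP; rewrite dE; split => //; exact: diff_continuous.
Unshelve. all: by end_near. Qed.

(** Markov's inequality in a form that applies to any [f], such as the gradient length of an
    infimum: K^p times the indicator of [A] is one of the simple functions over which the integral
    of |f|^p is a supremum. *)
Lemma Lnorm_ge_cst d (T : measurableType d) (R : realType)
    (mu : {measure set T -> \bar R}) (p K : R) (A : set T) (f : T -> R) :
  0 < p -> 0 <= K -> measurable A -> (forall z, A z -> K <= `|f z|) ->
  (K%:E * mu A `^ p^-1 <= 'N[mu]_p%:E[EFin \o f])%E.
Proof.
move=> p0 K0 mA Kf.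
have -> : (K%:E = (K `^ p)%:E `^ p^-1)%E.
  by rewrite poweR_EFin -powRrM mulfV ?gt_eqF// powRr1.
rewrite -poweRM ?lee_fin ?powR_ge0// unlock.
have Kp0 : 0 <= K `^ p by exact: powR_ge0.
have fp0 x : (0 <= `|(f x)%:E| `^ p)%E by exact: poweR_ge0.
apply: gt0_ler_poweR; rewrite ?invr_ge0 ?(ltW p0)// ?in_itv/= ?leey ?andbT.
- by rewrite mule_ge0.
- exact: integral_ge0.
rewrite [leRHS]ge0_integralTE//; apply: ereal_sup_ubound => /=.
exists (scale_nnsfun (indic_nnsfun R mA) Kp0).
  move=> x; rewrite /= measurable_realfun.mindicE lee_fin.
  have [/set_mem Ax|_] := boolP (x \in A); last by rewrite mulr0 powR_ge0.
  by rewrite mulr1; apply: ge0_ler_powR; rewrite ?nnegrE// ?(ltW p0)// Kf.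
rewrite -(@sintegral_indic _ _ R mu A) -(sintegralrM _ _ (indic_nnsfun R mA)).
by apply: eq_sintegral => x /=.
Qed.

Lemma derivable1_slice1 (R : realType) (f : R * R -> R) (x y : R) :
  differentiable f (x, y) ->
  is_derive x 1 (fun x' => f (x', y)) ('D_e1 f (x, y)).
Proof.
move=> df; have E : (fun h : R => h^-1 *: (f (h *: e1 + (x, y)) - f (x, y))) =
   (fun h : R => h^-1 *: (f (h *: (1 : R) + x, y) - f (x, y))).
  apply/funext => h; congr (_ *: (f _ - _)).
  by rewrite /e1; congr pair; rewrite /= scaler0 add0r.
have := @diff_derivable _ _ _ _ _ e1 df; rewrite /derivable E => cvf.
by split => //; rewrite /derive E.
Qed.

Lemma derivable1_slice2 (R : realType) (f : R * R -> R) (x y : R) :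
  differentiable f (x, y) ->
  is_derive y 1 (fun y' => f (x, y')) ('D_e2 f (x, y)).
Proof.
move=> df; have E : (fun h : R => h^-1 *: (f (h *: e2 + (x, y)) - f (x, y))) =
   (fun h : R => h^-1 *: (f (x, h *: (1 : R) + y) - f (x, y))).
  apply/funext => h; congr (_ *: (f _ - _)).
  by rewrite /e2; congr pair; rewrite /= scaler0 add0r.
have := @diff_derivable _ _ _ _ _ e2 df; rewrite /derivable E => cvf.
by split => //; rewrite /derive E.
Qed.

(** Only the x-derivative is kept; on the box the other one is at most of order h/Y, hence not
    larger than h/X. The equality on a neighbourhood yields differentiability, so [gradient_length]
    does not take its default value 0. *)
Lemma gradient_length_ge_powers (R : realType) (f : R * R -> R)
    (k P Q s s' x y : R) : 0 < x -> 0 < y ->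
  (\forall z \near (x, y), f z = k + (P * z.1 `^ s + Q * z.2 `^ s')) ->
  P * (s * x `^ (s - 1)) <= gradient_length f (x, y).
Proof.
move=> x0 y0 fE.
pose F (z : R * R) : R := k + (P * z.1 `^ s + Q * z.2 `^ s').
have dpow (e a : R) : 0 < a -> differentiable (fun r : R => r `^ e) a.
  move=> a0; apply/derivable1_diffP; apply: derivable_powR.
  by rewrite in_itv/= a0.
have dF : differentiable F (x, y).
  apply: differentiableD => //; apply: differentiableD; apply: differentiableM => //.
    apply: (differentiable_comp (f := fst) (g := fun r : R => r `^ s)); last exact: dpow.
    by apply: linear_differentiable; move=> ?; exact: cvg_fst.
  apply: (differentiable_comp (f := snd) (g := fun r : R => r `^ s')); last exact: dpow.
  by apply: linear_differentiable; move=> ?; exact: cvg_snd.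
have df : differentiable f (x, y).
  by apply: near_eq_differentiable dF; apply: filterS fE.
have Df : 'D_e1 f (x, y) = P * (s * x `^ (s - 1)).
  have -> : 'D_e1 f (x, y) = 'D_e1 F (x, y) by apply: near_eq_derive.
  have [_ <-] := derivable1_slice1 _ _ _ _ dF.
  have dp := is_derive1_powR s x0.
  have -> : (fun x' => F (x', y)) = cst k + (P *: (fun r : R => r `^ s) + cst (Q * y `^ s')) by [].
  have dF1 := is_deriveD (is_derive_cst k x 1)
    (is_deriveD (is_deriveZ P dp) (is_derive_cst (Q * y `^ s') x 1)).
  by have [_ ->] := dF1; rewrite add0r addr0.
rewrite /gradient_length asboolT// /norm2 /= Df.
apply: (le_trans (ler_norm _)); rewrite -sqrtr_sqr ler_sqrt ?lerDl ?sqr_ge0//.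
by rewrite addr_ge0 ?sqr_ge0.
Qed.

(** * The Hopf-Lax function of the cusp and its blow-up *)

Lemma hopf_lax_cusp_eq (R : realType) (s s' t b c h X Y : R) :
  1 < s' -> s' < s -> 0 < t -> 0 < b -> b < 2^-1 ->
  0 < c -> c `^ s + c `^ s' <= 1 -> s * c `^ (s - 1) + s' * c `^ (s' - 1) <= 1 ->
  0 < X -> X <= 1 -> X <= Y ->
  h = X `^ (2 * b) -> t `^ (1 - s) * X `^ s = h -> t `^ (1 - s') * Y `^ s' = h ->
  forall x y, 0 < x -> x <= c * X -> 0 < y -> y <= c * Y ->
  hopf_lax (lagrangian s s') (cusp b) t (x, y) =
  -1 + (t `^ (1 - s) * x `^ s + t `^ (1 - s') * y `^ s').
Proof.
move=> s'1 s's t0 b0 b1 c0 c1 c2 X0 X1 XY hE PX PY x y x0 xX y0 yY.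
apply: (@hopf_lax_eq _ _ _ _ _ 0).
  rewrite lagrangian_scale//= !sub0r !normrN !gtr0_norm//.
  rewrite /cusp /sqnorm /= !expr0n/= addr0 powR0 ?gt_eqF//.
  by rewrite minElt ltr01 sub0r.
move=> v; rewrite lagrangian_scale//=.
exact: (@cusp_well _ _ _ _ _ c h X Y).
Qed.

Lemma Lnorm_hopf_lax_cusp_ge (R : realType) (s s' t b c h X Y p : R) :
  1 < s' -> s' < s -> 0 < t -> 0 < b -> b < 2^-1 ->
  0 < c -> c `^ s + c `^ s' <= 1 -> s * c `^ (s - 1) + s' * c `^ (s' - 1) <= 1 ->
  0 < X -> X <= 1 -> X <= Y ->
  h = X `^ (2 * b) -> t `^ (1 - s) * X `^ s = h -> t `^ (1 - s') * Y `^ s' = h ->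
  0 < p ->
  ((s * (c / 2) `^ (s - 1) * (h / X) * ((c * X / 2) * (c * Y)) `^ p^-1)%:E <=
   'N[lebesgue2]_p%:E
     [EFin \o gradient_length (hopf_lax (lagrangian s s') (cusp b) t)])%E.
Proof.
move=> s'1 s's t0 b0 b1 c0 c1 c2 X0 X1 XY hE PX PY p0.
have h0 : 0 < h by rewrite hE powR_gt0.
have Y0 : 0 < Y by lra.
have cX0 : 0 < c * X by rewrite mulr_gt0.
have cY0 : 0 < c * Y by rewrite mulr_gt0.
have P0 : 0 < t `^ (1 - s) by rewrite powR_gt0.
(* Cutting off the half x <= cX/2 keeps x^(s-1) comparable to X^(s-1); the bound does not depend on
   y, so the other side stays whole. *)
pose I1 : set R := `]c * X / 2, c * X[%classic.
pose I2 : set R := `]0, c * Y[%classic.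
pose A : set (measurableTypeR R * measurableTypeR R) := I1 `*` I2.
have mA : measurable A by apply: measurableX; exact: measurable_itv.
have muA : lebesgue2 A = ((c * X / 2) * (c * Y))%:E.
  apply: (eq_trans (product_measure1E _ _ _ _)); [exact: measurable_itv..|].
  transitivity (@lebesgue_measure R I1 * @lebesgue_measure R I2)%E; first by [].
  rewrite /I1 /I2 !lebesgue_measure_itv/= !lte_fin cY0 ifT; last lra.
  by rewrite -!EFinB -EFinM; congr EFin; lra.
set K := s * _ * _.
have K0 : 0 <= K.
  by rewrite /K !mulr_ge0 ?powR_ge0 ?invr_ge0 ?(ltW h0) ?(ltW X0)//; lra.
have := @Lnorm_ge_cst _ _ R lebesgue2 p K A
  (gradient_length (hopf_lax (lagrangian s s') (cusp b) t)) p0 K0 mA.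
rewrite muA poweR_EFin -EFinM; apply => -[x y] Axy.
have /= := Axy; rewrite /A /I1 /I2 /= !in_itv/= => -[/andP[x1 x2] /andP[y1 y2]].
have x0 : 0 < x by lra.
apply: (le_trans _ (ler_norm _)).
apply: (@le_trans _ _ (t `^ (1 - s) * (s * x `^ (s - 1)))); last first.
  apply: (@gradient_length_ge_powers _ _ (-1) _ (t `^ (1 - s')) s s') => //.
  have : nbhs ((x, y) : R * R) (A : set (R * R)) 
    by exists (I1, I2) => //; split; apply: open_nbhs_nbhs; split => //;
      rewrite /I1 /I2 ?(in_itv, set_itvE)/= ?x1 ?y1//; exact: interval_open.
  apply: filterS => -[x' y'].
  rewrite /A /I1 /I2 /= !in_itv/= => -[/andP[x0' ?] /andP[? ?]].
  apply: (@hopf_lax_cusp_eq _ _ _ _ _ c h X Y) => //; try exact: ltW.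
  by apply: lt_trans x0'; rewrite divr_gt0.
have hX : t `^ (1 - s) * X `^ (s - 1) = h / X.
  by rewrite -PX [X `^ (s - 1)]powRB ?powRr1 ?(ltW X0)// ?(gt_eqF X0) ?implybT// mulrA.
rewrite /K -hX.
have -> : s * (c / 2) `^ (s - 1) * (t `^ (1 - s) * X `^ (s - 1)) =
  t `^ (1 - s) * (s * ((c / 2) `^ (s - 1) * X `^ (s - 1))) by ring.
rewrite ler_wpM2l ?(ltW P0)// ler_wpM2l//; first lra.
have c20 : 0 <= c / 2 by rewrite divr_ge0// ltW.
rewrite -powRM ?(ltW X0)//; apply: ler_powRl.
- by rewrite subr_ge0 ltW// (lt_trans s'1).
- by rewrite mulr_ge0// ltW.
- by rewrite mulrAC ltW.
Qed.

(** The witness solves 2 s c^(s'-1) = 1. As c <= 1 and s' - 1 is the smallest of the four exponents,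
    each of the four terms is at most s c^(s'-1) = 1/2. *)
Lemma exists_box_constant (R : realType) (s s' : R) : 1 < s' -> s' < s ->
  exists c : R, [/\ 0 < c, c `^ s + c `^ s' <= 1 &
    s * c `^ (s - 1) + s' * c `^ (s' - 1) <= 1].
Proof.
move=> s'1 s's; pose c := (2 * s) `^ (- (s' - 1)^-1).
have c0 : 0 < c by rewrite powR_gt0; lra.
have c1 : c <= 1.
  rewrite /c powRN invf_le1 ?powR_gt0; [|lra..].
  apply: (@le_trans _ _ (1 `^ (s' - 1)^-1)); first by rewrite powR1.
  by apply: ge0_ler_powR; rewrite ?nnegrE ?invr_ge0; lra.
have cs' : 2 * s * c `^ (s' - 1) = 1.
  rewrite /c -powRrM mulNr mulVf; last by rewrite gt_eqF//; lra.
  by rewrite powRN powRr1 ?divff// ?gt_eqF//; lra.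
have mono (x y : R) : y <= x -> c `^ x <= c `^ y.
  by move=> yx; apply: ger_powR; rewrite // c0 c1.
have m1 := mono s (s' - 1) ltac:(lra).
have m2 := mono s' (s' - 1) ltac:(lra).
have m3 := mono (s - 1) (s' - 1) ltac:(lra).
have w0 : 0 < c `^ (s' - 1) by rewrite powR_gt0.
have w1 : c `^ (s' - 1) <= s * c `^ (s' - 1) by rewrite ler_peMl; lra.
have w2 : s * c `^ (s - 1) <= s * c `^ (s' - 1) by rewrite ler_wpM2l; lra.
have w3 : s' * c `^ (s' - 1) <= s * c `^ (s' - 1) by rewrite ler_wpM2r; lra.
by exists c; split => //; lra.
Qed.

(** The last hypothesis is the positivity of the blow-up rate: X^((beta-1)p+2) Y/X has exponent
    ((beta-1)p+2) a - (a - a') in t, and multiplying its negativity by s'(s - beta) gives this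
    inequality. *)
Lemma cvg_Lnorm_hopf_lax_cusp (R : realType) (s s' p b : R) :
  1 < s' -> s' < s -> 2 < p -> 0 < b -> b < 2^-1 ->
  ((2 * b - 1) * p + 2) * (s - 1) * s' < (1 - 2 * b) * (s - s') ->
  ('N[lebesgue2]_p%:E
     [EFin \o gradient_length (hopf_lax (lagrangian s s') (cusp b) t)])%E
    @[t --> 0^'+] --> +oo%E.
Proof.
move=> s'1 s's p2 b0 b1 H.
have [c [c0 c1 c2]] := exists_box_constant R s s' s'1 s's.
pose be := 2 * b.
(* X = t^a and Y = t^a' solve the two equations of [cusp_well]. *)
pose a := (s - 1) / (s - be).
pose a' := (be * a + s' - 1) / s'.
(* The factor (h/X) (X Y)^(1/p) of the lower bound equals t^(-g). *)
pose g := - ((be - 1) * a + (a + a') / p).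
have sbe : 0 < s - be by rewrite /be; lra.
have aE : a * (s - be) = s - 1 by rewrite /a divfK// gt_eqF.
have a'E : a' * s' = be * a + s' - 1 by rewrite /a' divfK// gt_eqF//; lra.
have a0 : 0 < a by rewrite divr_gt0//; lra.
have adiff : s' * (s - be) * (a - a') = (1 - be) * (s - s').
  have -> : s' * (s - be) * (a - a') =
    s' * (a * (s - be)) - (s - be) * (a' * s') by ring.
  rewrite a'E.
  have -> : s' * (a * (s - be)) - (s - be) * (be * a + s' - 1) =
    s' * (a * (s - be)) - be * (a * (s - be)) - (s - be) * (s' - 1) by ring.
  by rewrite aE; ring.
have sbs : 0 < s' * (s - be) by rewrite mulr_gt0//; lra.
have a'a : a' <= a.
  rewrite -subr_ge0 -(pmulr_rge0 _ sbs) adiff mulr_ge0//; rewrite /be; lra.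
have g0 : 0 < g.
  rewrite /g oppr_gt0.
  have -> : (be - 1) * a + (a + a') / p = (((be - 1) * p + 2) * a - (a - a')) / p.
    by field; rewrite gt_eqF//; lra.
  rewrite pmulr_llt0 ?invr_gt0; last lra.
  rewrite subr_lt0 -(ltr_pM2l sbs) adiff.
  have -> : s' * (s - be) * (((be - 1) * p + 2) * a) =
   ((be - 1) * p + 2) * (a * (s - be)) * s' by ring.
  by rewrite aE.
pose C := s * (c / 2) `^ (s - 1) * (c * c / 2) `^ p^-1.
have C0 : 0 < C by rewrite /C !mulr_gt0 ?powR_gt0 ?divr_gt0 ?mulr_gt0//; lra.
apply/cvgeyPgey; near=> M.
have M0 : 0 < M by near: M; exact: nbhs_pinfty_gt.
near=> t.
have t0 : 0 < t by near: t; exact: nbhs_right_gt.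
have t1 : t <= 1 by near: t; apply: nbhs_right_le.
(* The right-hand side is the time at which C t^(-g) equals M. *)
have tM : t <= (C / M) `^ g^-1.
  by near: t; apply: nbhs_right_le; rewrite powR_gt0// divr_gt0.
have tD x y : t `^ x * t `^ y = t `^ (x + y).
  by rewrite powRD// (gt_eqF t0) implybT.
apply: le_trans (@Lnorm_hopf_lax_cusp_ge _ s s' t b c (t `^ (a * be)) (t `^ a)
  (t `^ a') p _ _ _ _ _ _ _ _ _ _ _ _ _ _ _) => //; last first.
- lra.
- rewrite -powRrM tD; congr (_ `^ _); move: a'E; lra.
- rewrite -powRrM tD; congr (_ `^ _); move: aE; lra.
- by rewrite -powRrM.
- by apply: ger_powR; rewrite ?t0.
- by rewrite -(powRr0 t); apply: ger_powR; rewrite ?t0 ?t1// ltW.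
- by rewrite powR_gt0.
have -> : (c * t `^ a / 2) * (c * t `^ a') = (c * c / 2) * t `^ (a + a').
  by rewrite -tD; field.
rewrite [(c * c / 2 * _) `^ _]powRM ?powR_ge0//; last first.
  by rewrite divr_ge0// mulr_ge0// ltW.
rewrite -[(t `^ (a + a')) `^ _]powRrM -powRN tD.
rewrite [X in (_ <= X%:E)%E](_ : _ = C * t `^ (- g)); last first.
  have -> : - g = a * be - a + (a + a') / p by rewrite /g; ring.
  by rewrite -(tD (a * be - a) ((a + a') / p)) /C; ring.
rewrite lee_fin powRN ler_pdivlMr ?powR_gt0// mulrC -ler_pdivlMr//.
have -> : C / M = ((C / M) `^ g^-1) `^ g.
  by rewrite -powRrM mulVf ?gt_eqF// powRr1// divr_ge0 ?ltW.
by apply: ge0_ler_powR; rewrite ?nnegrE ?powR_ge0 ?(ltW g0) ?(ltW t0).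
Unshelve. all: by end_near. Qed.

(** * Measurability and integrability on the plane *)

Lemma nbhs_itvoo_rat (R : realType) (x : R) (U : set R) : nbhs x U ->
  exists a b : rat, [/\ ratr a < x, x < ratr b &
    forall y : R, ratr a < y -> y < ratr b -> U y].
Proof.
move=> /nbhs_ballP[e /= e0 eU].
have /rat_in_itvoo[a] : x - e < x by lra.
rewrite in_itv/= => /andP[a1 a2].
have /rat_in_itvoo[b] : x < x + e by lra.
rewrite in_itv/= => /andP[b1 b2].
exists a, b; split => // y ay yb; apply: eU; rewrite /ball/= ltr_norml.
by apply/andP; split; lra.
Qed.

(** The boxes with rational endpoints inside [U] cover it and are countably many. [F] empties the
    other boxes, so that the union runs over a whole countable type. *)
Lemma open_measurable2 (R : realType) (U : set (R * R)) : open U ->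
  measurable (U : set (measurableTypeR R * measurableTypeR R)).
Proof.
move=> oU.
pose B (q : (rat * rat) * (rat * rat)) : set (measurableTypeR R * measurableTypeR R) :=
  [set` `]ratr q.1.1, ratr q.1.2[%R] `*` [set` `]ratr q.2.1, ratr q.2.2[%R].
pose F q : set (measurableTypeR R * measurableTypeR R) :=
  if `[< B q `<=` U >] then B q else set0.
have UF : U = \bigcup_q F q.
  apply/seteqP; split=> [[x y] Uxy|z [q _]]; last first.
    by rewrite /F; case: ifPn => [/asboolP Bq|_]; [exact: Bq|].
  have [[V W] [Vx Wy] VWU] : nbhs (x, y) U by exact: open_nbhs_nbhs.
  have [a [b [ax xb abV]]] := nbhs_itvoo_rat _ _ _ Vx.
  have [c [d [cy yd cdW]]] := nbhs_itvoo_rat _ _ _ Wy.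
  exists ((a, b), (c, d)) => //; rewrite /F ifT.
    by split; rewrite /B /= in_itv/=; apply/andP.
  apply/asboolP => -[x' y'] [] /=; rewrite !in_itv/= => /andP[? ?] /andP[? ?].
  by apply: VWU; split; [exact: abV|exact: cdW].
rewrite UF; apply: countable_bigcupT_measurable => //.
move=> q; rewrite /F; case: ifP => // _.
by apply: measurableX; exact: measurable_itv.
Qed.

Lemma continuous_measurable_fun2 (R : realType) (f : R * R -> R) :
  continuous f ->
  measurable_fun [set: measurableTypeR R * measurableTypeR R] f.
Proof.
move=> /continuousP cf; apply: (measurability _ (measurable_realfun.RGenOpens.measurableE R)).
move=> _ [_ [a [b ->] <-]]; rewrite setTI; apply: open_measurable2.
exact/cf/interval_open.
Qed.

(** A one-dimensional majorant with compact support. Products of two of these dominate all the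
    integrands on the plane: a = 0 serves for the cusp, a = 1/2 - b for its gradient. *)
Definition weight {R : realType} (a x : R) : R :=
  if `|x| <= 1 then `|x| `^ (- a) else 0.

Lemma weight_ge0 (R : realType) (a x : R) : 0 <= weight a x.
Proof. by rewrite /weight; case: ifP => // _; exact: powR_ge0. Qed.

Lemma measurable_weight (R : realType) (a : R) :
  measurable_fun [set: R] (weight a).
Proof.
apply: measurable_fun_ifT => //; first exact: measurable_fun_ler.
by apply: (@measurableT_comp _ _ _ _ _ _ (fun r : R => r `^ (- a)) _ (@Num.norm R R)).
Qed.

Lemma is_derive_powR_primitive (R : realType) (a x : R) : a != 1 -> 0 < x ->
  is_derive x 1 (fun y => (1 - a)^-1 * y `^ (1 - a)) (x `^ (- a)).
Proof.
move=> a1 x0; have dp := is_derive1_powR (1 - a) x0.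
have -> : (fun y => (1 - a)^-1 * y `^ (1 - a)) =
  (1 - a)^-1 *: (fun y : R => y `^ (1 - a)) by [].
apply: is_derive_eq; rewrite /GRing.scale/= mulKf; last by rewrite subr_eq0 eq_sym.
by congr (_ `^ _); ring.
Qed.

Lemma integral_powRN_le (R : realType) (a d : R) : a < 1 -> 0 < d -> d < 1 ->
  (\int[@lebesgue_measure R]_(x in `[d, 1%R]) (x `^ (- a))%:E <= (1 - a)^-1%:E)%E.
Proof.
move=> a1 d0 d1; have an1 : a != 1 by rewrite lt_eqF.
have dv (x : R) (x0 : 0 < x) := is_derive_powR_primitive R a x an1 x0.
have cp (e x : R) : 0 < x -> {for x, continuous (fun y : R => y `^ e)}.
  move=> x0; apply/differentiable_continuous/derivable1_diffP.
  by apply: derivable_powR; rewrite in_itv/= x0.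
have cF (x : R) : 0 < x -> {for x, continuous (fun y : R => (1 - a)^-1 * y `^ (1 - a))}.
  by move=> x0; apply: continuousM; [exact: cvg_cst|exact: cp].
rewrite (@continuous_FTC2 _ _ (fun y => (1 - a)^-1 * y `^ (1 - a)))//.
- rewrite -EFinB lee_fin powR1 mulr1 lerBlDr lerDl mulr_ge0 ?powR_ge0//.
  by rewrite invr_ge0; lra.
- apply: continuous_in_subspaceT => x; rewrite inE/= in_itv/= => /andP[dx _].
  by apply: cp; lra.
- split.
  + by move=> x; rewrite in_itv/= => /andP[dx _]; have [] := dv x ltac:(lra).
  + by apply: cvg_at_right_filter; apply: cF.
  + by apply: cvg_at_left_filter; apply: cF.
- move=> x; rewrite in_itv/= => /andP[dx _].
  by have [_ <-] := dv x ltac:(lra); rewrite derive1E.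
Qed.

(** The bound on [d, 1] is uniform in d, so it passes to ]0, 1] by monotone convergence; evenness of
    the weight handles the negative half-line. *)
Lemma integral_weight_lty (R : realType) (a : R) : a < 1 ->
  (\int[@lebesgue_measure R]_x (weight a x)%:E < +oo)%E.
Proof.
move=> a1.
have mw : measurable_fun [set: R] (EFin \o weight a).
  by apply/measurable_EFinP; exact: measurable_weight.
have w0 x : (0 <= (weight a x)%:E)%E by rewrite lee_fin weight_ge0.
(* [n.+2] keeps the left endpoint strictly below 1, as [integral_powRN_le] demands. *)
pose F n : set R := [set` `[n.+2%:R^-1, 1%R]%R].
have F01 : \bigcup_n F n = [set` `]0%R, 1%R]%R].
  apply/seteqP; split=> [x [n _]|x]; rewrite /F /= !in_itv/=.
    by move=> /andP[nx ->]; rewrite (lt_le_trans _ nx)// invr_gt0.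
  move=> /andP[x0 x1]; have [n] := ltr_add_invr x0.
  rewrite add0r => nx; exists n => //=; rewrite in_itv/= x1 andbT.
  by rewrite (le_trans _ (ltW nx))// lef_pV2 ?posrE// ler_nat.
have half : (\int[@lebesgue_measure R]_(x in `]0%R, 1%R]) (x `^ (- a))%:E <= (1 - a)^-1%:E)%E.
  rewrite -F01.
  have mp : measurable_fun [set: R] (fun x : R => (x `^ (- a))%:E).
    by apply/measurable_EFinP; exact: measurable_powR.
  have H : (\int[@lebesgue_measure R]_(x in F i) (x `^ (- a))%:E @[i --> \oo]
     --> \int[@lebesgue_measure R]_(x in \bigcup_i F i) (x `^ (- a))%:E)%E.
    apply: ge0_nondecreasing_set_cvg_integral.
    - move=> m n mn; apply/subsetPset => x; rewrite /F /= !in_itv/= => /andP[mx ->].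
      by rewrite andbT (le_trans _ mx)// lef_pV2 ?posrE// ler_nat !ltnS.
    - by move=> i; exact: measurable_itv.
    - by move=> i; exact: measurable_funTS.
    - by move=> i x _; rewrite lee_fin powR_ge0.
  rewrite -(cvg_lim _ H)//; apply: lime_le; first by apply/cvg_ex; eexists; exact: H.
  apply: nearW => n; apply: integral_powRN_le => //.
  by rewrite invf_lt1// ltr1n.
have pos : (\int[@lebesgue_measure R]_(x in `[0%R, +oo[) (weight a x)%:E < +oo)%E.
  rewrite -integral_itv_obnd_cbnd; last exact: measurable_funTS.
  apply: le_lt_trans (ltry (1 - a)^-1); apply: le_trans half.
  rewrite integral_mkcond [leRHS]integral_mkcond le_eqVlt; apply/orP; left; apply/eqP.
  apply: eq_integral => x _; rewrite !patchE /weight.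
  have -> : (x \in [set` `]0%R, +oo[%R]) = (0 < x) by apply/idP/idP; rewrite inE/= in_itv/= andbT.
  have -> : (x \in [set` `]0%R, 1%R]%R]) = (0 < x <= 1) by apply/idP/idP; rewrite inE/= in_itv/=.
  by case: ltP => //= x0; rewrite gtr0_norm//; case: ifP.
rewrite -(setUv [set` `[0%R, +oo[%R]) ge0_integral_setU//=; last 3 first.
- exact: measurableC.
- by rewrite setUv.
- exact/disj_setPCl.
rewrite lte_add_pinfty//.
apply: (@le_lt_trans _ _ (\int[@lebesgue_measure R]_(x in `]-oo, 0%R]) (weight a x)%:E)%E).
  apply: ge0_subset_integral => //; [exact: measurableC|exact: measurable_funTS|].
  by rewrite setCitvr; move=> x /=; rewrite !in_itv/= => /ltW.
have := @ge0_integration_by_substitution0 R (EFin \o weight a) mw w0.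
rewrite /=; under [in RHS]eq_integral do rewrite /weight normrN.
by move=> <-.
Qed.

Definition weight2 {R : realType} (a : R) (z : R * R) : R :=
  weight a z.1 * weight a z.2.

Lemma weight2_ge0 (R : realType) (a : R) (z : R * R) : 0 <= weight2 a z.
Proof. by rewrite mulr_ge0 ?weight_ge0. Qed.

Lemma measurable_weight2 (R : realType) (a : R) :
  measurable_fun [set: measurableTypeR R * measurableTypeR R] (weight2 a).
Proof.
apply: measurable_funM.
- exact: (measurableT_comp (measurable_weight R a) measurable_fst).
- exact: (measurableT_comp (measurable_weight R a) measurable_snd).
Qed.

Lemma integral_weight2_lty (R : realType) (a : R) : a < 1 ->
  (\int[lebesgue2]_z (weight2 a z)%:E < +oo)%E.
Proof.
move=> a1.
have -> : (\int[lebesgue2]_z (weight2 a z)%:E =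
    \int[@lebesgue_measure R]_x \int[@lebesgue_measure R]_y (weight2 a (x, y))%:E)%E.
  apply: fubini_tonelli1; last by move=> z; rewrite lee_fin weight2_ge0.
  by apply/measurable_EFinP; exact: measurable_weight2.
have mw : measurable_fun [set: R] (EFin \o weight a).
  by apply/measurable_EFinP; exact: measurable_weight.
have w0 x : (0 <= (weight a x)%:E)%E by rewrite lee_fin weight_ge0.
under eq_integral => x _.
  rewrite /weight2 /=; under eq_integral do rewrite EFinM.
  rewrite ge0_integralZl//.
  over.
rewrite ge0_integralZr//; last exact: integral_ge0.
by rewrite lte_mul_pinfty ?integral_ge0 ?integral_weight_lty//
  ge0_fin_numE ?integral_ge0 ?integral_weight_lty.
Qed.

Lemma integrable_le_weight2 (R : realType) (a C : R) (f : R * R -> R) :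
  a < 1 -> 0 <= C ->
  measurable_fun [set: measurableTypeR R * measurableTypeR R] f ->
  (forall z, `|f z| <= C * weight2 a z) ->
  lebesgue2.-integrable [set: measurableTypeR R * measurableTypeR R] (EFin \o f).
Proof.
move=> a1 C0 mf fC.
have mw2 : measurable_fun [set: measurableTypeR R * measurableTypeR R]
    (fun z => (weight2 a z)%:E).
  by apply/measurable_EFinP; exact: measurable_weight2.
apply/integrableP; split; first exact/measurable_EFinP.
apply: (@le_lt_trans _ _ (\int[lebesgue2]_z (C%:E * (weight2 a z)%:E))%E).
  apply: ge0_le_integral => //=.
  - by do 2 apply: measurableT_comp => //.
  - by apply: emeasurable_funM.
  - by move=> z _; rewrite -EFinM lee_fin.
rewrite ge0_integralZl//.
- by rewrite lte_mul_pinfty// integral_weight2_lty.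
- by move=> z _; rewrite lee_fin weight2_ge0.
Qed.

Lemma weight_powR (R : realType) (a p x : R) : 0 < p ->
  weight a x `^ p = weight (a * p) x.
Proof.
move=> p0; rewrite /weight; case: ifP => _; last by rewrite powR0// gt_eqF.
by rewrite -powRrM mulNr.
Qed.

(** The p-th power of a weight of exponent a is the weight of exponent a p, so membership in L^p
    reduces to integrability of a weight with a p < 1. *)
Lemma Lfun_le_weight2 (R : realType) (a C p : R) (f : R * R -> R) :
  0 < p -> a * p < 1 -> 0 <= C ->
  measurable_fun [set: measurableTypeR R * measurableTypeR R] f ->
  (forall z, `|f z| <= C * weight2 a z) ->
  f \in Lfun lebesgue2 p%:E.
Proof.
move=> p0 ap1 C0 mf fC; rewrite inE; apply/andP; split; first by rewrite inE.
rewrite inE /= /finite_norm unlock; apply: poweR_lty.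
have mfp : measurable_fun [set: measurableTypeR R * measurableTypeR R]
    (fun z => `|f z| `^ p).
  apply: (@measurableT_comp _ _ _ _ _ _ (fun r : R => r `^ p) _ (fun z => `|f z|)) => //.
  exact: measurableT_comp.
have := @integrable_le_weight2 R (a * p) (C `^ p) (fun z => `|f z| `^ p) ap1
  (powR_ge0 _ _) mfp.
move=> /(_ _)/integrableP[|_].
  move=> z; rewrite ger0_norm ?powR_ge0// /weight2 -!weight_powR//.
  rewrite -powRM ?weight_ge0// -powRM ?mulr_ge0 ?weight_ge0//.
  by apply: ge0_ler_powR; rewrite ?nnegrE ?(ltW p0) ?mulr_ge0 ?weight_ge0//; exact: fC.
apply: le_lt_trans; rewrite le_eqVlt; apply/orP; left; apply/eqP.
by apply: eq_integral => z _ /=; rewrite [in RHS]ger0_norm ?powR_ge0.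
Qed.

(** * Sobolev regularity of the cusp *)

(* The partial derivative in the first variable; the one in the second variable
   is [cusp_grad b \o swap].  It is set to 0 on the null set z.2 = 0, because
   there powR gives 0 to the negative powers in [weight2]. *)
Definition cusp_grad {R : realType} (b : R) (z : R * R) : R :=
  if (z.2 != 0) && (sqnorm z <= 1) then 2 * b * z.1 * sqnorm z `^ (b - 1) else 0.

Lemma continuous_sqnorm (R : realType) : continuous (@sqnorm R).
Proof.
move=> z; apply: cvgD; rewrite expr2.
  by apply: cvgM; exact: cvg_fst.
by apply: cvgM; exact: cvg_snd.
Qed.

(** The absolute value is there because [powR] takes a default value on negative bases, which would
    break continuity at 0. *)
Lemma continuous_norm_powR (R : realType) (b : R) : 0 < b ->
  continuous (fun r : R => `|r| `^ b).
Proof.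
move=> b0 r; have [->|r0] := eqVneq r 0; last first.
  apply: (@continuous_comp _ _ _ (@Num.norm R R) (fun s : R => s `^ b)).
    exact: norm_continuous.
  apply/differentiable_continuous/derivable1_diffP; apply: derivable_powR.
  by rewrite in_itv/= andbT normr_gt0.
rewrite /continuous_at normr0 powR0 ?gt_eqF//.
apply/cvgrPdist_lt => e e0; near=> x.
rewrite sub0r normrN ger0_norm ?powR_ge0//.
have -> : e = (e `^ b^-1) `^ b by rewrite -powRrM mulVf ?gt_eqF// powRr1// ltW.
apply: gt0_ltr_powR; rewrite ?nnegrE ?powR_ge0//.
near: x; apply/nbhs_ballP; exists (e `^ b^-1); first by rewrite /= powR_gt0.
by move=> x; rewrite /ball/= sub0r normrN.
Unshelve. all: by end_near. Qed.

Lemma continuous_cusp (R : realType) (b : R) : 0 < b -> continuous (@cusp R b).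
Proof.
move=> b0 z; rewrite /cusp.
have -> : (fun z : R * R => Num.min (sqnorm z `^ b) 1 - 1) =
    (fun z => Num.min (`|sqnorm z| `^ b) 1 - 1).
  by apply/funext => w; rewrite ger0_norm ?sqnorm_ge0.
apply: cvgB; last exact: cvg_cst.
apply: (@continuous_min _ _ (fun z => `|sqnorm z| `^ b) (cst 1)); last exact: cvg_cst.
apply: (@continuous_comp _ _ _ (@sqnorm R) (fun s : R => `|s| `^ b)).
  exact: continuous_sqnorm.
exact: continuous_norm_powR.
Qed.

Lemma radial_cusp (R : realType) (b : R) : radial (@cusp R b).
Proof.
move=> z w zw; rewrite /cusp.
have E (v : R * R) : sqnorm v = norm2 v ^+ 2 by rewrite sqr_sqrtr// sqnorm_ge0.
by rewrite !E zw.
Qed.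

Lemma cusp_eq0 (R : realType) (b : R) (z : R * R) : 0 <= b -> 1 <= sqnorm z ->
  cusp b z = 0.
Proof.
move=> b0 z1; rewrite /cusp min_r ?subrr//.
by have := ler_powRl _ _ _ _ b0 ler01 z1; rewrite powR1.
Qed.

Lemma sqnorm_le1_box (R : realType) (z : R * R) : sqnorm z <= 1 ->
  `|z.1| <= 1 /\ `|z.2| <= 1.
Proof.
have := sqr_ge0 z.1; have := sqr_ge0 z.2; rewrite /sqnorm => h1 h2 h.
by split; rewrite -(@ler_pXn2r _ 2) ?nnegrE// expr1n real_normK ?num_real//; lra.
Qed.

Lemma compactly_supported_cusp (R : realType) (b : R) : 0 <= b ->
  compactly_supported (@cusp R b).
Proof.
move=> b0; rewrite /compactly_supported.
have cbox : compact ([set` `[(-1 : R), 1]%R] `*` [set` `[(-1 : R), 1]%R]).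
  by apply: compact_setX; exact: segment_compact.
apply: (subclosed_compact _ cbox); first exact: closed_closure.
have box_closed : closed ([set` `[(-1 : R), 1]%R] `*` [set` `[(-1 : R), 1]%R]).
  apply: compact_closed => //; exact: norm_hausdorff.
rewrite closureE => z; apply; split => // w; apply: contraPP => /= wbox.
apply/negP; rewrite negbK; apply/eqP; apply: cusp_eq0 => //.
rewrite leNgt; apply/negP => /ltW /sqnorm_le1_box[w1 w2]; apply: wbox.
by split; rewrite /= in_itv/= -ler_norml.
Qed.

(** [weight2 0] is the indicator of the square [-1, 1]^2, since r^0 = 1 for [powR] even at r = 0. *)
Lemma cusp_le_weight2 (R : realType) (b : R) (z : R * R) : 0 <= b ->
  `|cusp b z| <= 1 * weight2 0 z.
Proof.
move=> b0; rewrite mul1r; have [z1|/ltW z1] := leP 1 (sqnorm z).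
  by rewrite cusp_eq0// normr0 weight2_ge0.
have [zx zy] := sqnorm_le1_box _ _ z1.
rewrite /weight2 /weight zx zy oppr0 !powRr0 mulr1 /cusp ler0_norm.
  by rewrite opprB lerBlDr lerDl le_min powR_ge0 ler01.
by rewrite subr_le0 ge_min lexx orbT.
Qed.

(* |x| |y| <= |z|^2 bounds the radial singularity by a product, so that Tonelli
   replaces polar coordinates. *)
Lemma cusp_grad_le_weight2 (R : realType) (b : R) (z : R * R) :
  0 < b -> b < 2^-1 -> `|cusp_grad b z| <= 2 * b * weight2 (2^-1 - b) z.
Proof.
move=> b0 b1; have b20 : 0 <= 2 * b by rewrite mulr_ge0// ltW.
rewrite /cusp_grad; case: ifPn => [/andP[y0 z1]|_]; last first.
  by rewrite normr0 mulr_ge0// weight2_ge0.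
have [zx zy] := sqnorm_le1_box _ _ z1.
(* On this axis [powR] makes the majorant 0, but the factor z.1 makes the derivative 0 as well. *)
have [x0|x0] := eqVneq z.1 0.
  by rewrite x0 mulr0 mul0r normr0 mulr_ge0// weight2_ge0.
rewrite -mulrA normrM (ger0_norm b20) ler_wpM2l//.
rewrite /weight2 /weight zx zy normrM (ger0_norm (powR_ge0 _ _)).
set X := `|z.1|; set Y := `|z.2|.
have X0 : 0 < X by rewrite normr_gt0.
have Y0 : 0 < Y by rewrite normr_gt0.
have qE : sqnorm z = X ^+ 2 + Y ^+ 2 by rewrite /X /Y !real_normK ?num_real.
have q0 : 0 < sqnorm z by rewrite qE addr_gt0// exprn_gt0.
have XYq : X * Y <= sqnorm z.
  have : 0 <= (X - Y) ^+ 2 by exact: sqr_ge0.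
  have : 0 < X * Y by rewrite mulr_gt0.
  by rewrite qE sqrrB; lra.
have Xq : X <= sqnorm z `^ 2^-1.
  have -> : X = (X ^+ 2) `^ 2^-1.
    by rewrite -powR_mulrn ?ltW// -powRrM divff// powRr1// ltW.
  by apply: ler_powRl; rewrite ?exprn_ge0 ?(ltW X0)// qE lerDl exprn_ge0// ltW.
(* The factor |z.1| <= |z| turns the exponent 2(b-1) of |z| into 2b-1, which is negative; so the
   lower bound X Y <= |z|^2 becomes an upper bound. *)
apply: (@le_trans _ _ (sqnorm z `^ 2^-1 * sqnorm z `^ (b - 1))).
  by rewrite ler_wpM2r// powR_ge0.
rewrite -powRD ?(gt_eqF q0) ?implybT// -powRM ?(ltW X0) ?(ltW Y0)//.
have -> : 2^-1 + (b - 1) = - (2^-1 - b) by lra.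
rewrite !powRN lef_pV2 ?posrE ?powR_gt0 ?mulr_gt0//.
by apply: ler_powRl => //; rewrite ?subr_ge0 ?mulr_ge0// ltW.
Qed.

Lemma measurable_cusp_grad (R : realType) (b : R) :
  measurable_fun [set: measurableTypeR R * measurableTypeR R] (@cusp_grad R b).
Proof.
have mq : measurable_fun [set: measurableTypeR R * measurableTypeR R] (@sqnorm R).
  exact: continuous_measurable_fun2 (continuous_sqnorm R).
apply: measurable_fun_ifT => //.
- apply: measurable_and; last exact: measurable_fun_ler.
  apply: measurable_neg; apply: measurable_fun_eqr => //; exact: measurable_snd.
- apply: measurable_funM.
  + by apply: measurable_funM => //; exact: measurable_fst.
  + exact: (@measurableT_comp _ _ _ _ _ _ (fun r : R => r `^ (b - 1)) _ (@sqnorm R)).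
Qed.

(** The line misses the origin, so x^2 + y^2 stays positive and its power b is differentiable in x.
    The boundary terms vanish because that power equals 1 at both ends of the chord cut out by the
    unit disc, whatever [psi] does there. *)
Lemma integral_cusp_line (R : realType) (b y : R) (psi dpsi : R -> R) :
  0 < b -> y != 0 -> (forall x : R, is_derive x 1 psi (dpsi x)) ->
  continuous dpsi ->
  (\int[@lebesgue_measure R]_x
     (cusp b (x, y) * dpsi x + cusp_grad b (x, y) * psi x)%:E = 0)%E.
Proof.
move=> b0 y0 dpsiE cdpsi.
have y20 : 0 < y ^+ 2 by rewrite exprn_even_gt0.
have q0 x : 0 < sqnorm (x, y) by rewrite /sqnorm/= ltr_wpDl// sqr_ge0.
(* Such a line meets the closed disc at most at x = 0, where [cusp_grad] vanishes through its factor
   x. *)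
have [y1|y1] := leP 1 (y ^+ 2).
  apply: integral0_eq => x _.
  have q1 : 1 <= sqnorm (x, y) by rewrite /sqnorm/= (le_trans y1)// lerDr sqr_ge0.
  rewrite cusp_eq0 ?(ltW b0)// mul0r add0r /cusp_grad /= y0 /=.
  case: ifPn => [q1'|_]; last by rewrite mul0r.
  have x20 : x ^+ 2 <= 0 by move: q1'; rewrite /sqnorm/=; lra.
  have : x ^+ 2 == 0 by rewrite eq_le x20 sqr_ge0.
  by rewrite sqrf_eq0 => /eqP ->; rewrite mulr0 !mul0r.
(* Half the length of the chord. *)
pose c := Num.sqrt (1 - y ^+ 2).
have c0 : 0 < c by rewrite sqrtr_gt0 subr_gt0.
have c2 : c ^+ 2 = 1 - y ^+ 2 by rewrite sqr_sqrtr// subr_ge0 ltW.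
have inc x : (sqnorm (x, y) <= 1) = (- c <= x <= c).
  rewrite -ler_norml -(@ler_pXn2r _ 2 isT `|x| c) ?nnegrE ?(ltW c0)//.
  by rewrite real_normK ?num_real// c2 /sqnorm/= lerBrDr.
pose q (x : R) := x ^+ 2 + y ^+ 2.
pose f (x : R) := (q x `^ b - 1) * dpsi x + (2 * b * x * q x `^ (b - 1)) * psi x.
pose F (x : R) := (q x `^ b - 1) * psi x.
have dq (x : R) : is_derive x 1 q (2 * x).
  have -> : q = @id R * @id R + cst (y ^+ 2) by apply/funext => r; rewrite /q expr2.
  have d0 := is_derive_id x (1 : R).
  have [d1 d2] := is_deriveD (is_deriveM d0 d0) (is_derive_cst (y ^+ 2) x (1 : R)).
  by split => //; rewrite d2 addr0 /GRing.scale/= mulr1 mulr_natl.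
have dqb (x : R) : is_derive x 1 (fun x : R => q x `^ b) (2 * b * x * q x `^ (b - 1)).
  have d1 := @is_derive1_comp _ (fun r : R => r `^ b) q x _ _ (is_derive1_powR b (q0 x)) (dq x).
  by apply: is_derive_eq d1 _; rewrite /q /sqnorm /=; ring.
have dF (x : R) : is_derive x 1 F (f x).
  have [d1 d2] := is_deriveM (is_deriveB (dqb x) (is_derive_cst (1 : R) x (1 : R))) (dpsiE x).
  split => //; rewrite [LHS]d2.
  by rewrite subr0 /f /GRing.scale /= !fctE; ring.
have cts (g dg : R -> R) : (forall x : R, is_derive x 1 g (dg x)) -> continuous g.
  by move=> dg' x; apply/differentiable_continuous/derivable1_diffP; have [] := dg' x.
have cqp e : continuous (fun x : R => q x `^ e).
  move=> x; apply: (@continuous_comp _ _ _ q (fun r : R => r `^ e)).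
    exact: (cts q _ dq).
  apply/differentiable_continuous/derivable1_diffP; apply: derivable_powR.
  by rewrite in_itv/= andbT; exact: q0.
have cf : continuous f.
  move=> x; apply: cvgD; apply: cvgM.
  - by apply: cvgB; [exact: cqp|exact: cvg_cst].
  - exact: cdpsi.
  - by apply: cvgM; [apply: cvgM; [exact: cvg_cst|exact: cvg_id]|exact: cqp].
  - exact: (cts psi _ dpsiE).
transitivity (\int[@lebesgue_measure R]_(x in [set` `[(- c)%R, c]%R]) (f x)%:E)%E.
  rewrite [RHS]integral_mkcond; apply: eq_integral => x _; rewrite patchE.
  have -> : (x \in [set` `[(- c), c]%R]) = (sqnorm (x, y) <= 1).
    by rewrite inc; apply/idP/idP; rewrite inE/= in_itv/=.
  case: ifPn => [q1|]; last first.
    rewrite -ltNge => q1; rewrite cusp_eq0 ?(ltW q1) ?(ltW b0)// mul0r add0r.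
    by rewrite /cusp_grad leNgt q1 andbF mul0r.
  rewrite /cusp_grad q1 y0 /= /cusp min_l//.
  by have := ler_powRl _ _ _ _ (ltW b0) (ltW (q0 x)) q1; rewrite powR1.
rewrite (@continuous_FTC2 _ _ F).
- have Fc x : x ^+ 2 = c ^+ 2 -> F x = 0.
    by move=> xc; rewrite /F /q xc c2 subrK powR1 subrr mul0r.
  by rewrite !Fc ?sqrrN// sube0.
- by rewrite gt0_cp.
- exact: continuous_subspaceT.
- split.
  + by move=> x _; have [] := dF x.
  + by apply: cvg_at_right_filter; exact: (cts F _ dF).
  + by apply: cvg_at_left_filter; exact: (cts F _ dF).
- by move=> x _; have [_ <-] := dF x; rewrite derive1E.
Qed.

(** * From lines to weak derivatives on the plane *)

Lemma continuous_bounded_box (R : realType) (phi : R * R -> R) : continuous phi ->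
  exists2 M, 0 <= M & forall z, `|z.1| <= 1 -> `|z.2| <= 1 -> `|phi z| <= M.
Proof.
move=> cphi.
have cbox : compact ([set` `[(-1 : R), 1]%R] `*` [set` `[(-1 : R), 1]%R]).
  by apply: compact_setX; exact: segment_compact.
have := @continuous_compact _ _ phi _ (continuous_subspaceT cphi) cbox.
move=> /compact_bounded [M [_ HM]].
exists (`|M| + 1) => [|z z1 z2]; first by rewrite addr_ge0.
apply: (HM (`|M| + 1)); first by rewrite (le_lt_trans (ler_norm M))// ltrDl.
by exists z => //; split; rewrite /= in_itv/= -ler_norml.
Qed.

(** [phi] matters only on the unit square: off it [weight2] vanishes and forces [f] to vanish
    too. *)
Lemma weight2_mul_le (R : realType) (a C M : R) (f phi : R * R -> R) :
  (forall z, `|f z| <= C * weight2 a z) ->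
  (forall z, `|z.1| <= 1 -> `|z.2| <= 1 -> `|phi z| <= M) ->
  forall z, `|f z * phi z| <= C * M * weight2 a z.
Proof.
move=> fC phiM z; rewrite normrM.
have [/andP[z1 z2]|zbox] := boolP ((`|z.1| <= 1) && (`|z.2| <= 1)).
  by rewrite mulrAC ler_pM ?fC ?phiM.
have w0 : weight2 a z = 0.
  by move: zbox; rewrite /weight2 /weight; do 2 case: ifP => // _; rewrite ?mul0r ?mulr0.
have := fC z; rewrite w0 !mulr0 => f0.
have -> : `|f z| = 0 by apply/le_anti; rewrite f0 normr_ge0.
by rewrite mul0r.
Qed.

Lemma integral_eq0_off0 (R : realType) (G : R -> \bar R) :
  measurable_fun [set: R] G -> (forall y, y != 0 -> G y = 0%E) ->
  (\int[@lebesgue_measure R]_y G y = 0)%E.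
Proof.
move=> mG G0; rewrite -[RHS](integral0 (@lebesgue_measure R) [set: R]).
apply: ae_eq_integral => //.
exists [set 0]; split => //; first exact: lebesgue_measure_set1.
move=> y /= H; apply: contrapT => /eqP y0; apply: H => _.
exact: G0.
Qed.

(** Fubini with the line through the singularity left out: it is a single point, hence a null set,
    for the outer integral. *)
Lemma integral_lebesgue2_lines1 (R : realType) (k : R * R -> R) :
  lebesgue2.-integrable [set: measurableTypeR R * measurableTypeR R] (EFin \o k) ->
  (forall y, y != 0 -> (\int[@lebesgue_measure R]_x (k (x, y))%:E = 0)%E) ->
  (\int[lebesgue2]_z (k z)%:E = 0)%E.
Proof.
move=> ik k0.
have E := integral21_prod_meas1 ik; rewrite -[LHS]E.
apply: integral_eq0_off0 => //.
exact: measurable_fubini_G ik.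
Qed.

Lemma integral_lebesgue2_lines2 (R : realType) (k : R * R -> R) :
  lebesgue2.-integrable [set: measurableTypeR R * measurableTypeR R] (EFin \o k) ->
  (forall x, x != 0 -> (\int[@lebesgue_measure R]_y (k (x, y))%:E = 0)%E) ->
  (\int[lebesgue2]_z (k z)%:E = 0)%E.
Proof.
move=> ik k0.
have E := integral12_prod_meas1 ik; rewrite -[LHS]E.
apply: integral_eq0_off0 => //.
exact: measurable_fubini_F ik.
Qed.

(** The cusp is invariant under this reflection, which carries the estimates for its first partial
    derivative over to the second. *)
Definition swap {R : realType} (z : R * R) : R * R := (z.2, z.1).

Lemma sqnorm_swap (R : realType) (z : R * R) : sqnorm (swap z) = sqnorm z.
Proof. by rewrite /sqnorm /= addrC. Qed.

Lemma weight2_swap (R : realType) (a : R) (z : R * R) :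
  weight2 a (swap z) = weight2 a z.
Proof. by rewrite /weight2 mulrC. Qed.

(* The combined integrand [f D_e phi + g phi] is the derivative of [f phi]
   along lines, so its plane integral vanishes by Fubini. *)
Lemma weak_derivative_of_integral0 (R : realType) (a C C' : R) (e : R * R)
    (f g : R * R -> R) : a < 1 -> 0 <= C -> 0 <= C' ->
  measurable_fun [set: measurableTypeR R * measurableTypeR R] f ->
  measurable_fun [set: measurableTypeR R * measurableTypeR R] g ->
  (forall z, `|f z| <= C * weight2 0 z) ->
  (forall z, `|g z| <= C' * weight2 a z) ->
  (forall phi, test_function phi -> continuous ('D_e phi)) ->
  (forall phi, test_function phi ->
    lebesgue2.-integrable [set: measurableTypeR R * measurableTypeR R]
      (EFin \o (fun z => f z * 'D_e phi z + g z * phi z)) ->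
    (\int[lebesgue2]_z (f z * 'D_e phi z + g z * phi z)%:E = 0)%E) ->
  weak_derivative e f g.
Proof.
move=> a1 C0 C'0 mf mg fC gC cD int0 phi tphi.
have cphi : continuous phi by have := tphi.1 0%N.
have cDphi := cD _ tphi.
have [M M0 phiM] := continuous_bounded_box R phi cphi.
have [M' M'0 DphiM] := continuous_bounded_box R _ cDphi.
have mphi := continuous_measurable_fun2 R phi cphi.
have mDphi := continuous_measurable_fun2 R _ cDphi.
have i1 : lebesgue2.-integrable [set: measurableTypeR R * measurableTypeR R]
    (EFin \o (fun z => f z * 'D_e phi z)).
  apply: (@integrable_le_weight2 R 0 (C * M')); rewrite ?mulr_ge0//.
    exact: measurable_funM.
  exact: weight2_mul_le fC DphiM.
have i2 : lebesgue2.-integrable [set: measurableTypeR R * measurableTypeR R]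
    (EFin \o (fun z => g z * phi z)).
  apply: (@integrable_le_weight2 R a (C' * M)); rewrite ?mulr_ge0//.
    exact: measurable_funM.
  exact: weight2_mul_le gC phiM.
have i12 : lebesgue2.-integrable [set: measurableTypeR R * measurableTypeR R]
    (EFin \o (fun z => f z * 'D_e phi z + g z * phi z)).
  exact: (integrableD measurableT i1 i2).
have := int0 _ tphi i12.
have -> : (\int[lebesgue2]_z (f z * 'D_e phi z + g z * phi z)%:E =
    \int[lebesgue2]_z (f z * 'D_e phi z)%:E + \int[lebesgue2]_z (g z * phi z)%:E)%E.
  exact: (integralD measurableT i1 i2).
(* Finiteness of both integrals allows the vanishing sum to be solved for one of them in the
   extended reals. *)
have f1 := integrable_fin_num measurableT i1.
have f2 := integrable_fin_num measurableT i2.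
move: f1 f2; rewrite /comp.
case: (\int[lebesgue2]_z (f z * 'D_e phi z)%:E)%E => // r1 _.
case: (\int[lebesgue2]_z (g z * phi z)%:E)%E => // r2 _.
by rewrite -EFinD => -[/eqP]; rewrite addr_eq0 => /eqP ->.
Qed.

(** The condition (1/2 - b) p < 1 says beta > 1 - 2/p, which is also what polar coordinates would
    give for |z|^(beta-1): the product majorant loses nothing. *)
Lemma W1_cusp (R : realType) (b p : R) : 0 < b -> b < 2^-1 -> 1 <= p ->
  (2^-1 - b) * p < 1 -> W1 p (cusp b).
Proof.
move=> b0 b1 p1 bp; have p0 : 0 < p by exact: lt_le_trans p1.
have b20 : 0 <= 2 * b by rewrite mulr_ge0// ltW.
have a1 : 2^-1 - b < 1 by lra.
have mc := continuous_measurable_fun2 R _ (continuous_cusp R b b0).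
have cC z := cusp_le_weight2 R b z (ltW b0).
have mg := measurable_cusp_grad R b.
have gC z := cusp_grad_le_weight2 R b z b0 b1.
have mg' : measurable_fun [set: measurableTypeR R * measurableTypeR R]
    (cusp_grad b \o swap).
  apply: (measurableT_comp mg); exact: measurable_swap.
have gC' z : `|(cusp_grad b \o swap) z| <= 2 * b * weight2 (2^-1 - b) z.
  by rewrite -[weight2 _ z]weight2_swap; exact: gC.
split; first by apply: (@Lfun_le_weight2 R 0 1) => //; rewrite mul0r.
exists (cusp_grad b), (cusp_grad b \o swap); split.
- exact: (@Lfun_le_weight2 R (2^-1 - b) (2 * b)).
- exact: (@Lfun_le_weight2 R (2^-1 - b) (2 * b)).
- apply: (@weak_derivative_of_integral0 R (2^-1 - b) 1 (2 * b)) => //.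
    by move=> phi [/(_ 1%N)[]].
  move=> phi [/(_ 1%N)[dphi cD _] _] ik.
  apply: integral_lebesgue2_lines1 => // y y0.
  apply: (@integral_cusp_line R b y (fun x => phi (x, y))) => //.
    by move=> x; exact: derivable1_slice1.
  move=> x; apply: (@continuous_comp _ _ _ (fun x : R => (x, y)) ('D_e1 phi)).
    exact: (cvg_pair cvg_id (cvg_cst y)).
  exact: cD.
- apply: (@weak_derivative_of_integral0 R (2^-1 - b) 1 (2 * b)) => //.
    by move=> phi [/(_ 1%N)[]].
  move=> phi [/(_ 1%N)[dphi _ cD] _] ik.
  apply: integral_lebesgue2_lines2 => // x x0.
  rewrite -[RHS](@integral_cusp_line R b x (fun y => phi (x, y)) (fun y => 'D_e2 phi (x, y)))//.
  + apply: eq_integral => y _; congr (_ * _ + _)%:E.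
    by rewrite /cusp -[in LHS]sqnorm_swap.
  + by move=> y; exact: derivable1_slice2.
  + move=> y; apply: (@continuous_comp _ _ _ (fun y : R => (x, y)) ('D_e2 phi)).
      exact: (cvg_pair (cvg_cst x) cvg_id).
    exact: cD.
Qed.

(** * Choice of the exponent *)

Theorem mainTheorem5 (R : realType) (s s' : R) (hs' : 1 < s') (hs : s' < s)
    (p : R) (hp : 2 < p) :
  exists u : R * R -> R,
    [/\ continuous u, compactly_supported u, radial u, W1 p u &
        ('N[lebesgue2]_p%:E
          [EFin \o gradient_length (hopf_lax (lagrangian s s') u t)])%E
          @[t --> 0^'+] --> +oo%E].
Proof.
have p0 : 0 < p by lra.
(* With 2b = 1 - 2/p + e the blow-up condition reads e K < 2 (s - s')/p; [e] is half of this
   threshold. *)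
pose K := p * (s - 1) * s' + (s - s').
have D0 : 0 < p * (s - 1) * s' by rewrite !mulr_gt0//; lra.
have K0 : 0 < K by rewrite /K; lra.
pose e := (s - s') / (p * K).
have e0 : 0 < e by rewrite divr_gt0 ?mulr_gt0//; lra.
have eK : e * K = (s - s') * p^-1 by rewrite /e; field; rewrite !gt_eqF.
have ip0 : 0 < p^-1 by rewrite invr_gt0.
have ip2 : p^-1 < 2^-1 by rewrite ltf_pV2 ?posrE//; lra.
have e1 : e <= p^-1.
  by rewrite -(ler_pM2r K0) eK [leLHS]mulrC ler_wpM2l ?(ltW ip0)// /K; lra.
(* p > 2 makes [b] positive, and e <= 1/p keeps it below 1/2. *)
pose b := 2^-1 - p^-1 + e / 2.
have b0 : 0 < b by rewrite /b; lra.
have b1 : b < 2^-1 by rewrite /b; lra.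
have bp : (2 * b - 1) * p + 2 = e * p by rewrite /b; field; rewrite gt_eqF.
exists (cusp b); split.
- exact: continuous_cusp.
- exact: compactly_supported_cusp (ltW b0).
- exact: radial_cusp.
- have ep : 0 < e * p by rewrite mulr_gt0.
  apply: W1_cusp => //; first lra.
  by move: bp; lra.
- apply: cvg_Lnorm_hopf_lax_cusp => //.
  have -> : 1 - 2 * b = 2 * p^-1 - e by rewrite /b; field; rewrite gt_eqF.
  have pos : 0 < (s - s') * p^-1 by rewrite mulr_gt0//; lra.
  rewrite bp -subr_gt0.
  have -> : (2 * p^-1 - e) * (s - s') - e * p * (s - 1) * s' =
    2 * ((s - s') * p^-1) - e * K by rewrite /K; ring.
  by rewrite eK; lra.
Qed.
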